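(* Let $\Gamma=\mathrm{Circ}(n;S)$ be a connected circulant graph or digraph. Let $\alpha\in\mathrm{Aut}(\Gamma)$ fix the vertex $0$ and respect the partition $\mathcal C$ (so that $\alpha(C)\in\mathcal C$ for every $C\in\mathcal C$). Then $\alpha\in\mathrm{Aut}(\mathbb Z_n)$, i.e. $\alpha$, regarded as a permutation of the vertex set $\mathbb Z_n$, is an automorphism of the group $\mathbb Z_n$.
   Context: Let $n$ be a positive integer, $\mathbb Z_n$ the cyclic group of integers modulo $n$ (written additively), and $S\subseteq\mathbb Z_n$ with $0\notin S$. The circulant digraph $\mathrm{Circ}(n;S)$ has vertex set $\mathbb Z_n$ and an arc $(g,g+s)$ for every $g\in\mathbb Z_n$ and $s\in S$. If $S=-S$, the two arcs $(g,g+s)$ and $(g+s,g)$ are combined into a single undirected edge $\{g,g+s\}$, and $\mathrm{Circ}(n;S)$ denotes the resulting undirected (simple) graph, called a circulant graph. $\mathrm{Aut}(\Gamma)$ is the group of permutations of the vertex set preserving edges (respectively, arcs). $\Gamma$ is connected if and only if $\langle S\rangle=\mathbb Z_n$. The partition $\mathcal C$ of the arc set (digraph case) is $$\mathcal C=\bigl\{\{(g,g+s): g\in H\} : s\in S,\ H \text{ a coset of } \langle s\rangle \text{ in } \mathbb Z_n\bigr\}.$$ In the undirected case ($S=-S$), each ordered pair $(g,g+s)$ is replaced by the unordered pair $\{g,g+s\}$ and duplicates are eliminated, so that $\mathcal C$ is a set (not a multiset) partitioning the edge set. Thus each part of $\mathcal C$ consists of the edges (or arcs) of one cycle all of whose edges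 are generated by a single element of $S$ (a single edge if $s$ has order $2$ in the undirected case). An automorphism $\beta$ respects a partition $\{A_1,\dots,A_m\}$ of the edge (arc) set if $\{A_1,\dots,A_m\}=\{\beta(A_1),\dots,\beta(A_m)\}$, where $\beta$ acts on edges (arcs) via its action on vertices. *)

(* Defs.v *)
From mathcomp Require Import all_boot all_order all_algebra all_fingroup.
Set Implicit Arguments.
Unset Strict Implicit.
Unset Printing Implicit Defensive.
Import GRing.Theory.
Local Open Scope ring_scope.

(* The cyclic group of order n.+1 is the additive group on 'I_n.+1; unlike
   'Z_n.+1, this is also correct for the trivial group (n = 0).  Its
   finGroupType structure, used below for <[s]>, rcosets and Aut, has addition
   as group law. *)

Section Circulant.
Variable n : nat.
Implicit Types (S : {set 'I_n.+1}) (b : {perm 'I_n.+1}).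

Definition circ_undirected S : bool := [set - s | s in S] == S.

Definition circ_arcs S : {set 'I_n.+1 * 'I_n.+1} :=
  [set (g, g + s) | g in [set: 'I_n.+1], s in S].

Definition circ_edges S : {set {set 'I_n.+1}} :=
  [set [set g; g + s] | g in [set: 'I_n.+1], s in S].

(* Connectedness ignores the orientation of arcs. *)
Definition circ_connected S : Prop :=
  forall x y : 'I_n.+1,
    connect [rel u v | ((u, v) \in circ_arcs S) || ((v, u) \in circ_arcs S)]
      x y.

Definition arc_act b (a : 'I_n.+1 * 'I_n.+1) : 'I_n.+1 * 'I_n.+1 :=
  (b a.1, b a.2).

Definition edge_act b (e : {set 'I_n.+1}) : {set 'I_n.+1} := b @: e.

Definition circ_aut S : {set {perm 'I_n.+1}} :=
  if circ_undirected S
  then [set b | [set edge_act b e | e in circ_edges S] == circ_edges S]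
  else [set b | [set arc_act b a | a in circ_arcs S] == circ_arcs S].

Definition arc_partition S : {set {set 'I_n.+1 * 'I_n.+1}} :=
  [set [set (g, g + s) | g in (H : {set 'I_n.+1})]
     | s in S, H in rcosets <[s]>%g [set: 'I_n.+1]].

Definition edge_partition S : {set {set {set 'I_n.+1}}} :=
  [set [set [set g; g + s] | g in (H : {set 'I_n.+1})]
     | s in S, H in rcosets <[s]>%g [set: 'I_n.+1]].

Definition respects (E : finType) (act : E -> E) (P : {set {set E}}) : Prop :=
  [set act @: A | A : {set E} in P] = P.

Definition circ_respects S b : Prop :=
  if circ_undirected S
  then respects (edge_act b) (edge_partition S)
  else respects (arc_act b) (arc_partition S).

End Circulant.

(* Main.v *)
Require Import Defs.
From mathcomp Require Import all_boot all_order all_algebra all_fingroup.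
Set Implicit Arguments.
Unset Strict Implicit.
Unset Printing Implicit Defensive.
Import GRing.Theory FinRing.Theory.
Local Open Scope ring_scope.

(** The argument works one prime at a time.  Since [alpha] permutes the cycles
    that make up the partition, it is affine on every coset of every [<s>],
    [s] in [S], with a slope that may depend on the coset
    ([circ_respects_affine]).  This and the connectedness of the graph already
    force additivity ([affine_on_cosets_additive]):

    For a prime [p] dividing the order [N] of the group, let [q] be the [p]-part
    of [N] and [m] its [p']-part, so that multiplication by [m] kills exactly
    the [p']-component of an element.  Moving from [x] to [x + q s] changes
    [alpha x] by some [q t], which [m] kills; since [S] generates the group,
    [m * alpha x] depends only on [x] modulo [q].  Not every element of [S] is
    divisible by [p], so some [s] in [S] generates the group modulo [q], and the
    single affine formula for [alpha] on [<s>] describes [m * alpha] everywhere.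
    Hence [m * alpha] is additive.  So the defect
    [alpha (x + y) - alpha x - alpha y] has trivial [p]-component for each [p],
    and vanishes. *)

Section CyclicGroup.
Variable n : nat.
Local Notation N := n.+1.
Implicit Types (x y z g s t : 'I_N) (S : {set 'I_N}).

Lemma ord_mulrn_eq0 x k : (x *+ k == 0) = (N %| x * k)%N.
Proof. by rewrite Zp_mulrn -val_eqE. Qed.

Lemma ord_mulrn_card x : x *+ N = 0.
Proof. by apply/eqP; rewrite ord_mulrn_eq0 dvdn_mull. Qed.

(** Multiplication by the [p']-part of the group order is the projection to the
    [p]-component up to an automorphism of that component. *)
Lemma eq0_pcomponents x :
  (forall p, p \in \pi(N) -> x *+ N`_p^' = 0) -> x = 0.
Proof.
move=> x0; suff: x *+ 1 == 0 by rewrite mulr1n => /eqP.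
rewrite ord_mulrn_eq0 muln1; apply/dvdn_partP => // p /x0/eqP.
rewrite ord_mulrn_eq0 -{1}(partnC p (ltn0Sn n)).
by rewrite dvdn_pmul2r ?part_gt0.
Qed.

(** Connectedness enters only in this form: [S] generates the group. *)
Lemma circ_connected_ind S (P : 'I_N -> Prop) :
  circ_connected S -> P 0 ->
  (forall x s, s \in S -> P x -> P (x + s)) ->
  (forall x s, s \in S -> P x -> P (x - s)) ->
  forall x, P x.
Proof.
move=> conn P0 PD PB x; have /connectP[w] := conn 0 x.
elim: w 0 P0 => [|y w IHw] z Pz /=; first by move=> _ ->.
case/andP=> zy; apply: IHw.
case/orP: zy => /imset2P[g s _ sS [-> ->]] in Pz *; first exact: PD.
by move/(PB _ _ sS): Pz; rewrite addrK.
Qed.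

(** If a prime [p] divided every element of [S], multiplication by [N / p] would
    kill [S], hence the whole group, which it does not. *)
Lemma circ_connected_ndvd S p :
  circ_connected S -> p \in \pi(N) -> exists2 s, s \in S & ~~ (p %| s)%N.
Proof.
move=> conn; rewrite mem_primes => /and3P[p_pr _ pN].
apply/exists_inP; apply: contraT; rewrite negb_exists_in => /forall_inP pS.
have [r defN] := dvdnP pN.
have r_gt0 : (0 < r)%N by case: r defN.
have kill : forall x, x *+ r = 0.
  apply: (circ_connected_ind conn) => [|x s sS xr0|x s sS xr0].
  - exact: mul0rn.
  - rewrite mulrnDl xr0 add0r; apply/eqP; rewrite ord_mulrn_eq0 {1}defN.
    by rewrite mulnC dvdn_pmul2r //; apply: contraNT (pS s sS).
  - rewrite mulrnBl xr0 sub0r; apply/eqP; rewrite oppr_eq0 ord_mulrn_eq0.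
    by rewrite {1}defN mulnC dvdn_pmul2r //; apply: contraNT (pS s sS).
have := kill (inord 1); move/eqP; rewrite ord_mulrn_eq0 inordK; last first.
  exact: leq_trans (prime_gt1 p_pr) (dvdn_leq _ pN).
rewrite mul1n => /(dvdn_leq r_gt0); rewrite defN leqNgt.
by rewrite ltn_Pmulr ?prime_gt1.
Qed.

(** An element that is prime to [q] generates the group modulo [q] (Bezout). *)
Lemma coprime_generates_mod s q y :
  (0 < s)%N -> coprime s q -> exists z c, y + z *+ q = s *+ c.
Proof.
move=> s_gt0 co_s_q; case: (egcdnP q s_gt0) => u v; rewrite (eqP co_s_q).
move=> defu _; exists (y *+ v), (u * y)%N.
by rewrite -mulrnA -{1}[y]mulr1n -mulrnDr !Zp_mulrn mulnA
           [(s * u)%N]mulnC defu addnC mulnC.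
Qed.

(** Slopes on different cosets of [<s>] may differ a priori, but for each prime [p]
    a shift by [q s] alters [f] by a multiple of the [p]-part [q] of [N], invisible
    in the [p]-component, and the slope on [<s>] itself, for one [s] prime to [p],
    determines that component everywhere. *)
Lemma affine_on_cosets_additive S (f : 'I_N -> 'I_N) :
  circ_connected S -> f 0 = 0 ->
  (forall s g, s \in S -> exists t, forall k, f (g + s *+ k) = f g + t *+ k) ->
  {morph f : x y / x + y}.
Proof.
move=> conn f0 aff x y; apply/eqP; rewrite -subr_eq0; apply/eqP.
apply: eq0_pcomponents => p piNp; set q := (N`_p)%N; set m := (N`_p^')%N.
have qm0 t : t *+ q *+ m = 0 by rewrite -mulrnA partnC // ord_mulrn_card.
(* Multiplied by [m], the map [f] only sees its argument modulo [q]. *)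
have shift : forall z u, f (u + z *+ q) *+ m = f u *+ m.
  apply: (circ_connected_ind conn) => [|z s sS IHz u|z s sS IHz u].
  - by move=> u; rewrite mul0rn addr0.
  - have [t ft] := aff s (u + z *+ q) sS.
    by rewrite mulrnDl addrA ft mulrnDl qm0 addr0.
  - have [t ft] := aff s (u + (z - s) *+ q) sS.
    rewrite -[LHS]addr0 -(qm0 t) -mulrnDl -ft -addrA -mulrnDl subrK.
    exact: IHz.
have [s sS ps] := circ_connected_ndvd conn piNp.
have s_gt0 : (0 < s)%N by rewrite lt0n; apply: contraNneq ps => ->.
have co_s_q : coprime s q.
  rewrite coprime_sym /q p_part coprimeXl // prime_coprime //.
  by move: piNp; rewrite mem_primes => /andP[].
have [z [c xE]] := coprime_generates_mod x s_gt0 co_s_q.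
have [z' [c' yE]] := coprime_generates_mod y s_gt0 co_s_q.
(* So its values can all be read off the single subgroup generated by [s]. *)
have [t] := aff s 0 sS; rewrite f0 => ft.
have fs k : f (s *+ k) = t *+ k by rewrite -[RHS]add0r -ft add0r.
rewrite mulrnBl mulrnDl -(shift (z + z')) -(shift z x) -(shift z' y).
by rewrite mulrnDl addrACA xE yE -mulrnDr !fs -mulrnDl -mulrnDr subrr.
Qed.
End CyclicGroup.

Section Cycles.
Variables (n : nat) (S : {set 'I_n.+1}) (b : {perm 'I_n.+1}).
Implicit Types (g h s t : 'I_n.+1).

Lemma mem_cycle_coset g s k : g + s *+ k \in (<[s]> :* g)%g.
Proof.
by apply/rcosetP; exists (s *+ k); [apply/cycleP; exists k | rewrite addrC].
Qed.

(** A directed cycle of step [s] goes to a directed cycle, whose step is the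
    slope. *)
Lemma arc_respects_affine s g :
  respects (arc_act b) (arc_partition S) -> s \in S ->
  exists t, forall k, b (g + s *+ k) = b g + t *+ k.
Proof.
move=> resp sS.
have: [set arc_act b a | a in [set (h, h + s) | h in (<[s]> :* g)%g]]
        \in arc_partition S.
  by rewrite -resp; apply/imset_f/imset2_f => //; apply/rcosetsP; exists g.
case/imset2P=> t H' _ _ defH'; exists t; elim=> [|k IHk].
  by rewrite !mulr0n !addr0.
have: arc_act b (g + s *+ k, g + s *+ k + s) \in [set (h, h + t) | h in H'].
  by rewrite -defH'; do 2!apply: imset_f; apply: mem_cycle_coset.
case/imsetP=> h _ [bh]; rewrite -bh IHk => bhs.
by rewrite mulrSr addrA bhs mulrSr addrA.
Qed.

(** Along the image of an undirected cycle each step is [t] or [- t], and what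
    has to be excluded is a change of sign.  Such a change would bring the walk
    back to where it was two steps before, so by injectivity [s + s = 0]; the
    cycle is then a single edge, as is its image, and [t = - t] after all. *)
Lemma edge_respects_affine s g :
  respects (edge_act b) (edge_partition S) -> s \in S ->
  exists t, forall k, b (g + s *+ k) = b g + t *+ k.
Proof.
move=> resp sS.
have: [set edge_act b e | e in [set [set h; h + s] | h in (<[s]> :* g)%g]]
        \in edge_partition S.
  by rewrite -resp; apply/imset_f/imset2_f => //; apply/rcosetsP; exists g.
case/imset2P=> t H' _ /rcosetsP[g' _ ->] defH'.
have two_torsion : s + s = 0 -> t + t = 0.
  move=> ss0.
  (* Every edge of the image part is the image of the only edge of the part. *)
  have one_edge k : [set g' + t *+ k; g' + t *+ k + t] = b @: [set g; g + s].
    have: [set g' + t *+ k; g' + t *+ k + t]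
            \in [set [set h; h + t] | h in (<[t]> :* g')%g].
      by apply: imset_f; apply: mem_cycle_coset.
    rewrite -defH' => /imsetP[_ /imsetP[h gh ->] ->]; congr (b @: _).
    case/rcosetP: gh => _ /cycleP[i ->] ->; rewrite zmodMgE zmodXgE.
    rewrite -(odd_double_half i) mulrnDr -muln2 mulnC (mulrnA s 2).
    rewrite [s *+ 2]ss0 mul0rn addr0; case: (odd i); rewrite ?add0r //.
    by rewrite mulr1n addrC -addrA ss0 addr0 setUC.
  have: g' \in [set g' + t *+ 1; g' + t *+ 1 + t].
    by rewrite one_edge -(one_edge 0) mulr0n addr0 !inE eqxx.
  rewrite !inE mulr1n -addrA.
  case/orP=> /eqP/esym/(canRL (addKr _)); rewrite addNr => // ->.
  by rewrite addr0.
have step k : b (g + s *+ k.+1) = b (g + s *+ k) + t \/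
              b (g + s *+ k.+1) = b (g + s *+ k) - t.
  have: edge_act b [set g + s *+ k; g + s *+ k + s]
          \in [set [set h; h + t] | h in (<[t]> :* g')%g].
    by rewrite -defH'; do 2!apply: imset_f; apply: mem_cycle_coset.
  rewrite mulrSr addrA; move: (g + s *+ k) => x.
  case/imsetP=> h _; rewrite /edge_act imsetU1 imset_set1 => /setP e_h.
  have := e_h h; have := e_h (h + t); have := e_h (b x).
  have := e_h (b (x + s)).
  rewrite !inE !eqxx ?orbT /= => /esym/orP[]/eqP-> /esym/orP[]/eqP->.
  + by rewrite orbb => /eqP->; left.
  + by right; rewrite addrK.
  + by left.
  + by move=> _; rewrite orbb => /eqP e; left; rewrite -!e.
have same_step k : b (g + s *+ k.+2) = b (g + s *+ k.+1) +
                                   (b (g + s *+ k.+1) - b (g + s *+ k)).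
  have back : b (g + s *+ k.+2) = b (g + s *+ k) -> t = - t.
    move/perm_inj/addrI; rewrite !mulrSr -addrA => /(canRL (addKr _)).
    by rewrite addNr => /two_torsion/eqP; rewrite addr_eq0 => /eqP.
  have [] := step k; have [] := step k.+1 => e2 e1; rewrite e2 e1 in back *.
  + by rewrite [_ + t - _]addrAC subrr add0r.
  + by rewrite [b _ + t - b _]addrAC subrr add0r -back ?addrK.
  + by rewrite [b _ - t - b _]addrAC subrr add0r -back ?subrK.
  + by rewrite [b _ - t - b _]addrAC subrr add0r.
exists (b (g + s) - b g) => k.
(* The second-order recurrence needs two consecutive values to start. *)
suff [] : b (g + s *+ k) = b g + (b (g + s) - b g) *+ k /\
          b (g + s *+ k.+1) = b g + (b (g + s) - b g) *+ k.+1 by [].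
elim: k => [|k [IH0 IH1]].
  by rewrite !mulr0n !addr0 !mulr1n addrCA subrr addr0.
split=> //; rewrite same_step IH1 IH0 opprD.
rewrite [_ + (- b g - _)]addrACA subrr add0r -mulrnBr // subSnn.
by rewrite mulr1n -addrA -mulrSr.
Qed.
End Cycles.

Lemma circ_respects_affine n (S : {set 'I_n.+1}) b (s g : 'I_n.+1) :
  circ_respects S b -> s \in S ->
  exists t, forall k, b (g + s *+ k) = b g + t *+ k.
Proof.
rewrite /circ_respects; case: ifP => _.
  exact: edge_respects_affine.
exact: arc_respects_affine.
Qed.

Theorem theorem2p5 (n : nat) (S : {set 'I_n.+1}) (S0 : 0 \notin S)
    (conn : circ_connected S) (alpha : {perm 'I_n.+1})
    (aut_alpha : alpha \in circ_aut S) (alpha0 : alpha 0 = 0)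
    (resp_alpha : circ_respects S alpha) :
  alpha \in Aut [set: 'I_n.+1].
Proof.
rewrite inE; apply/andP; split; first by apply/subsetP=> x _; rewrite inE.
apply/morphicP=> x y _ _.
apply: affine_on_cosets_additive conn alpha0 _ x y => s g.
exact: circ_respects_affine.
Qed.
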